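(* Let $c=(1,1)$, let $\mathcal{P}_c$ be the set of all cylindric partitions with profile $c$, and let $F_c(1,q)=\sum_{\Lambda\in\mathcal{P}_c} q^{|\Lambda|}$ be their generating function. Then $$F_c(1,q) = \frac{(-q;q^2)_\infty}{(q;q)_\infty}.$$
   Context: A partition is a finite (possibly empty) weakly decreasing sequence of positive integers $\lambda=(\lambda_1\ge\lambda_2\ge\cdots\ge\lambda_s)$; set $\lambda_j=0$ for $j>s$. For $c=(c_1,c_2)$ a pair of nonnegative integers, a cylindric partition with profile $c$ is a pair $\Lambda=(\lambda^{(1)},\lambda^{(2)})$ of partitions such that for all $j\ge 1$, $\lambda^{(1)}_j\ge \lambda^{(2)}_{j+c_2}$ and $\lambda^{(2)}_j\ge\lambda^{(1)}_{j+c_1}$. In particular, for $c=(1,1)$ the conditions are $\lambda^{(1)}_j\ge\lambda^{(2)}_{j+1}$ and $\lambda^{(2)}_j\ge\lambda^{(1)}_{j+1}$ for all $j\ge1$. The size $|\Lambda|$ is the sum of all the parts of $\lambda^{(1)}$ and $\lambda^{(2)}$. Notation: $(a;q)_\infty=\prod_{i\ge0}(1-aq^i)$, so $(-q;q^2)_\infty=\prod_{i\ge 0}(1+q^{2i+1})$. Identities are between formal power series in $q$. *)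

(* Defs.v *)
From HB Require Import structures.
From mathcomp Require Import all_boot all_order all_algebra finmap.
From mathcomp Require Import boolp classical_sets functions cardinality fsbigop filter.

Set Implicit Arguments.
Unset Strict Implicit.
Unset Printing Implicit Defensive.

Import Order.TTheory GRing.Theory Num.Theory.
Local Open Scope classical_set_scope.
Local Open Scope ring_scope.

(* The ring R[[q]] of formal power series; [p]_n is the coefficient of q^n. *)

Record fps (R : Type) := Fps { fps_coef : nat -> R }.

Notation "[ p ]_ n" := (fps_coef p n)
  (at level 0, p at level 200, n at level 0, format "[ p ]_ n") : ring_scope.

HB.instance Definition _ (R : Type) := gen_eqMixin (fps R).
HB.instance Definition _ (R : Type) := gen_choiceMixin (fps R).

Lemma fpsP (R : Type) (p r : fps R) : (forall n, [p]_n = [r]_n) <-> p = r.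
Proof.
split=> [|-> //]; case: p r => [f] [g] /= fg.
by congr Fps; apply/funext.
Qed.

Section Zmodule.
Variable R : zmodType.
Implicit Types p r s : fps R.

Definition fps0 : fps R := Fps (fun=> 0).
Definition fps_opp p : fps R := Fps (fun n => - [p]_n).
Definition fps_add p r : fps R := Fps (fun n => [p]_n + [r]_n).

Fact fps_addA : associative fps_add.
Proof. by move=> p r s; apply/fpsP => n /=; rewrite addrA. Qed.
Fact fps_addC : commutative fps_add.
Proof. by move=> p r; apply/fpsP => n /=; rewrite addrC. Qed.
Fact fps_add0 : left_id fps0 fps_add.
Proof. by move=> p; apply/fpsP => n /=; rewrite add0r. Qed.
Fact fps_addN : left_inverse fps0 fps_opp fps_add.
Proof. by move=> p; apply/fpsP => n /=; rewrite addNr. Qed.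

HB.instance Definition _ :=
  GRing.isZmodule.Build (fps R) fps_addA fps_addC fps_add0 fps_addN.

Lemma coef_fps0 n : [0 : fps R]_n = 0. Proof. by []. Qed.
Lemma coef_fpsN p n : [- p]_n = - [p]_n. Proof. by []. Qed.
Lemma coef_fpsD p r n : [p + r]_n = [p]_n + [r]_n. Proof. by []. Qed.
Lemma coef_fpsB p r n : [p - r]_n = [p]_n - [r]_n. Proof. by []. Qed.

Lemma coef_fps_sum I (s : seq I) (P : pred I) (F : I -> fps R) n :
  [\sum_(i <- s | P i) F i]_n = \sum_(i <- s | P i) [F i]_n.
Proof.
by elim/big_rec2: _ => [|i x y _ <-]; rewrite ?coef_fps0 ?coef_fpsD.
Qed.

End Zmodule.

Section Ring.
Variable R : comNzRingType.
Implicit Types (p r s : fps R) (P Q : {poly R}).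

Definition fps1 : fps R := Fps (fun n => (n == 0%N)%:R).
Definition fps_mul p r : fps R :=
  Fps (fun n => \sum_(i < n.+1) [p]_i * [r]_(n - i)).

Let trunc m p : {poly R} := \poly_(i < m.+1) [p]_i.

Let coef_trunc m p i : (i <= m)%N -> (trunc m p)`_i = [p]_i.
Proof. by rewrite coef_poly ltnS => ->. Qed.

Let fps_mul_poly m p r P Q :
  (forall i, (i <= m)%N -> P`_i = [p]_i) ->
  (forall i, (i <= m)%N -> Q`_i = [r]_i) ->
  forall i, (i <= m)%N -> (P * Q)`_i = [fps_mul p r]_i.
Proof.
move=> eP eQ i im; rewrite coefM /=; apply: eq_bigr => j _.
have jm : (j <= m)%N by rewrite (leq_trans _ im) // -ltnS.
by rewrite eP // eQ // (leq_trans (leq_subr _ _) im).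
Qed.

Fact fps_mulA : associative fps_mul.
Proof.
move=> p r s; apply/fpsP => n.
have e t := @coef_trunc n t.
rewrite -(fps_mul_poly (e p) (fps_mul_poly (e r) (e s))) // mulrA.
exact: (fps_mul_poly (fps_mul_poly (e p) (e r)) (e s)).
Qed.

Fact fps_mulC : commutative fps_mul.
Proof.
move=> p r; apply/fpsP => n; have e t := @coef_trunc n t.
rewrite -(fps_mul_poly (e p) (e r)) // mulrC.
exact: (fps_mul_poly (e r) (e p)).
Qed.

Fact fps_mul1 : left_id fps1 fps_mul.
Proof.
move=> p; apply/fpsP => n /=; rewrite big_ord_recl /= mul1r subn0.
by rewrite big1 ?addr0 // => i _; rewrite mul0r.
Qed.

Fact fps_mulDl : left_distributive fps_mul +%R.
Proof.
move=> p r s; apply/fpsP => n /=; rewrite -big_split /=.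
by apply: eq_bigr => i _; rewrite mulrDl.
Qed.

Fact fps1_neq0 : fps1 != 0.
Proof.
apply/eqP => /(congr1 (fun p => [p]_0)) /= /eqP.
by rewrite oner_eq0.
Qed.

HB.instance Definition _ := GRing.Zmodule_isComNzRing.Build (fps R)
  fps_mulA fps_mulC fps_mul1 fps_mulDl fps1_neq0.

Definition fpsX : fps R := Fps (fun n => (n == 1%N)%:R).

Lemma coef_fps1 n : [1 : fps R]_n = (n == 0%N)%:R. Proof. by []. Qed.
Lemma coef_fpsM p r n : [p * r]_n = \sum_(i < n.+1) [p]_i * [r]_(n - i).
Proof. by []. Qed.

Lemma coef0_fpsM p r : [p * r]_0 = [p]_0 * [r]_0.
Proof. by rewrite coef_fpsM big_ord1. Qed.

Lemma coef_fpsMX p n : [fpsX * p]_n = if n is m.+1 then [p]_m else 0.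
Proof.
rewrite coef_fpsM; case: n => [|n]; first by rewrite big_ord1 mul0r.
rewrite big_ord_recl mul0r add0r big_ord_recl /= mul1r subn1 /=.
by rewrite big1 ?addr0 // => i _; rewrite mul0r.
Qed.

Lemma coef_fpsXn k n : [fpsX ^+ k]_n = (n == k)%:R.
Proof.
elim: k n => [|k IHk] n //; rewrite exprS coef_fpsMX.
by case: n => [|n] //; rewrite IHk eqSS.
Qed.

Lemma fps_mul_val p r k l :
  (forall n, (n < k)%N -> [p]_n = 0) -> (forall n, (n < l)%N -> [r]_n = 0) ->
  forall n, (n < k + l)%N -> [p * r]_n = 0.
Proof.
move=> pk rl n nkl; rewrite coef_fpsM big1 // => i _.
have [ik|ki] := ltnP i k; first by rewrite pk ?mul0r.
have iN : (i <= n)%N by rewrite -ltnS.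
by rewrite rl ?mulr0 // ltn_subLR // (leq_trans nkl) // leq_add2r.
Qed.

Lemma fps_exp_val p k n : [p]_0 = 0 -> (n < k)%N -> [p ^+ k]_n = 0.
Proof.
move=> p0; elim: k n => // k IHk n nk; rewrite exprS.
by apply: (@fps_mul_val _ _ 1 k) => // -[|].
Qed.

End Ring.

(* Otherwise simplification unfolds the ring operations inside [p]_n. *)
Arguments fps_coef : simpl never.

Lemma coef_Fps (R : Type) (f : nat -> R) n : [Fps f]_n = f n.
Proof. by []. Qed.

Notation "''q'" := (fpsX _) : ring_scope.

Section UnitRing.
Variable R : comUnitRingType.
Implicit Types p r : fps R.

Definition fps_unit : {pred fps R} := fun p => [p]_0 \is a GRing.unit.

(* If [p]_0 = a is a unit, then p = a (1 - u) with [u]_0 = 0, so that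
   p^-1 = a^-1 (1 + u + u^2 + ...), and the coefficient of q^n only involves
   the powers of u up to n. *)
Definition fps_inv p : fps R :=
  if [p]_0 \is a GRing.unit then
    let u := Fps (fun n => (n == 0%N)%:R - [p]_0^-1 * [p]_n) : fps R in
    Fps (fun n => [p]_0^-1 * \sum_(k < n.+1) [u ^+ k]_n)
  else p.

Fact fps_mulVr : {in fps_unit, left_inverse 1 fps_inv *%R}.
Proof.
move=> p pU; rewrite /fps_inv (pU : [p]_0 \is a GRing.unit) /=.
set a := [p]_0; set u := Fps (fun n => (n == 0%N)%:R - _).
have u0 : [u]_0 = 0 by rewrite coef_Fps mulVr ?subrr.
have pE i : [p]_i = a * [1 - u]_i.
  by rewrite coef_fpsB coef_fps1 coef_Fps opprB addrC subrK mulrA divrr ?mul1r.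
apply/fpsP => n.
have -> : [Fps (fun n => a^-1 * \sum_(k < n.+1) [u ^+ k]_n) * p]_n =
          [(\sum_(k < n.+1) u ^+ k) * (1 - u)]_n.
  rewrite !coef_fpsM; apply: eq_bigr => i _; rewrite pE.
  rewrite coef_Fps.
  rewrite mulrCA !mulrA divrr // mul1r coef_fps_sum; congr (_ * _).
  rewrite (big_ord_widen _ (fun k => [u ^+ k]_i) (ltn_ord i)).
  rewrite big_mkcond; apply: eq_bigr => k _.
  by case: ltnP => // ik; rewrite fps_exp_val.
have -> : (\sum_(k < n.+1) u ^+ k) * (1 - u) = 1 - u ^+ n.+1.
  rewrite mulrC -[in RHS](expr1n _ n.+1) subrXX; congr (_ * _).
  by apply: eq_bigr => k _; rewrite expr1n mul1r.
by rewrite coef_fpsB fps_exp_val // subr0.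
Qed.

Fact fps_unitPl p r : r * p = 1 -> fps_unit p.
Proof.
move/(congr1 (fun s => [s]_0)); rewrite coef0_fpsM coef_fps1 /= => rp.
by apply/unitrPr; exists [r]_0; rewrite mulrC.
Qed.

Fact fps_inv_out : {in [predC fps_unit], fps_inv =1 id}.
Proof. by move=> p /negbTE; rewrite /fps_unit unfold_in /fps_inv => ->. Qed.

HB.instance Definition _ := GRing.ComNzRing_hasMulInverse.Build (fps R)
  fps_mulVr fps_unitPl fps_inv_out.

Lemma fps_unitE p : (p \is a GRing.unit) = ([p]_0 \is a GRing.unit).
Proof. by []. Qed.

End UnitRing.

(* Coefficientwise limits: a sequence of power series converges when each
   coefficient is eventually constant; coefficients that do not stabilise are
   given the value 0. *)
Definition fps_lim (R : nmodType) (u : nat -> fps R) : fps R :=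
  Fps (fun n => xget 0 [set a | \forall N \near \oo, [u N]_n = a]).

Definition fps_cvg (R : nmodType) (u : nat -> fps R) : Prop :=
  forall n, exists a, \forall N \near \oo, [u N]_n = a.

Lemma fps_limP (R : nmodType) (u : nat -> fps R) : fps_cvg u ->
  forall n, \forall N \near \oo, [u N]_n = [fps_lim u]_n.
Proof. by move=> cu n; exact: (xgetPex 0 (cu n)). Qed.

(* qpoch a p is (a;p)_oo = \prod_(i >= 0) (1 - a p^i). *)
Definition qpoch (R : comNzRingType) (a p : fps R) : fps R :=
  fps_lim (fun N => \prod_(i < N) (1 - a * p ^+ i)).

(* Sum of a possibly infinite family, meaningful when each power of q occurs
   in finitely many members. *)
Definition fps_fsum (R : nmodType) (I : choiceType) (A : set I)
    (F : I -> fps R) : fps R :=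
  Fps (fun n => \sum_(i \in A) [F i]_n).

Section QPochhammer.
Variable R : comNzRingType.
Implicit Types a p : fps R.

Lemma qpoch_stable a p n : [p]_0 = 0 -> forall N, (n < N)%N ->
  [\prod_(i < N) (1 - a * p ^+ i)]_n = [\prod_(i < n.+1) (1 - a * p ^+ i)]_n.
Proof.
move=> p0 N; elim: N => // N IHN; rewrite ltnS leq_eqVlt => /orP[/eqP -> //|nN].
rewrite big_ord_recr /= mulrBr mulr1 coef_fpsB IHN //.
rewrite mulrA (@fps_mul_val _ _ _ 0 N) ?subr0 // => m mN.
exact: fps_exp_val.
Qed.

Lemma qpoch_cvg a p : [p]_0 = 0 ->
  fps_cvg (fun N => \prod_(i < N) (1 - a * p ^+ i)).
Proof. by move=> p0 n; eexists; exists n.+1 => // N; exact: qpoch_stable. Qed.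

Lemma coef_qpoch a p n : [p]_0 = 0 ->
  [qpoch a p]_n = [\prod_(i < n.+1) (1 - a * p ^+ i)]_n.
Proof.
move=> p0; have [N _ NP] := fps_limP (qpoch_cvg a p0) n.
rewrite -(NP (maxn N n.+1)) /= ?leq_maxl // qpoch_stable //.
by rewrite leq_max ltnSn orbT.
Qed.

End QPochhammer.

Lemma qpoch_unit (R : comUnitRingType) :
  qpoch ('q : fps R) 'q \is a GRing.unit.
Proof.
rewrite fps_unitE coef_qpoch // big_ord1 expr0 mulr1 coef_fpsB coef_fps1 /=.
by rewrite subr0 unitr1.
Qed.

Definition is_part (l : seq nat) : bool := sorted geq l && (0%N \notin l).

(* Parts are numbered from 0, and nth 0 l j = 0 when j is out of range. *)
Definition cylindric (c : nat * nat) : set (seq nat * seq nat) :=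
  [set L | [/\ is_part L.1, is_part L.2,
     forall j, (nth 0 L.2 (j + c.2) <= nth 0 L.1 j)%N &
     forall j, (nth 0 L.1 (j + c.1) <= nth 0 L.2 j)%N]].

Definition cyl_size (L : seq nat * seq nat) : nat := (sumn L.1 + sumn L.2)%N.

(* F_c(1,q) *)
Definition cyl_genfun (c : nat * nat) : fps int :=
  fps_fsum (cylindric c) (fun L => 'q ^+ cyl_size L).

Lemma finite_part_sumn n :
  finite_set [set l | is_part l /\ (sumn l <= n)%N].
Proof.
pose f (b : {bseq n of 'I_n.+1}) : seq nat := map val b.
apply: (@sub_finite_set _ _ (f @` setT)); last exact: finite_image.
move=> l /= [/andP[_ l0] ln].
have sz : (size l <= n)%N.
  apply: leq_trans ln; elim: l l0 => //= x l IHl.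
  rewrite inE negb_or eq_sym -lt0n => /andP[x0 /IHl].
  by rewrite -add1n; exact: leq_add.
have le x : x \in l -> (x <= n)%N.
  move=> xl; apply: leq_trans ln; elim: l xl {l0 sz} => //= y l IHl.
  rewrite inE => /predU1P[->|/IHl h]; first exact: leq_addr.
  exact: leq_trans h (leq_addl _ _).
have szi : (size (map inord l : seq 'I_n.+1) <= n)%N by rewrite size_map.
exists (Bseq szi) => //; rewrite /f /= -map_comp -[RHS]map_id.
by apply/eq_in_map => x xl /=; rewrite inordK // ltnS le.
Qed.

Lemma finite_cylindric c n :
  finite_set [set L | cylindric c L /\ cyl_size L = n].
Proof.
apply: sub_finite_set (finite_setX (finite_part_sumn n) (finite_part_sumn n)).
by move=> [l m] /= [[/= pl pm _ _] <-]; split; split; rewrite // ?leq_addr ?leq_addl.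
Qed.

Lemma coef_cyl_genfun c n : [cyl_genfun c]_n =
  (#|` fset_set [set L | cylindric c L /\ cyl_size L = n]|)%:R.
Proof.
rewrite coef_Fps.
rewrite -(@fsbig_widen _ _ 0 +%R [set L | cylindric c L /\ cyl_size L = n]
  (cylindric c)); first last.
- move=> L /= [cL nL]; rewrite coef_fpsXn; case: eqP => // e.
  by exfalso; apply: nL.
- by move=> L [].
rewrite fsbig_finite /=; last exact: finite_cylindric.
rewrite (eq_big_seq (fun=> 1)); last first.
  move=> L; rewrite in_fset_set ?inE; last exact: finite_cylindric.
  by case=> _ <-; rewrite coef_fpsXn eqxx.
by rewrite big_const_seq count_predT iter_addr_0 cardfE.
Qed.

(* Main.v *)
Require Import Defs.
From mathcomp Require Import all_boot all_order all_algebra.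
From mathcomp Require Import ring zify.
From mathcomp Require Import boolp classical_sets functions cardinality fsbigop.

(** A pair (l, m) of partitions is cylindric of profile (1, 1) exactly when
    l_(j+1) and m_(j+1) are both at most min(l_j, m_j).  Sorting each pair
    {l_j, m_j} thus gives one partition x_1 >= x_2 >= x_3 >= ..., and the pair is
    recovered from x by choosing, for every j with x_(2j-1) > x_(2j), which of
    l and m gets the larger value.  In terms of the conjugate of x this is a
    factor 2 for each odd part size that occurs, so the generating function is
    the product of (1 + q^k)/(1 - q^k) over odd k and of 1/(1 - q^k) over
    even k, which is (-q; q^2)_oo / (q; q)_oo.

    The proof carries this out one column at a time, without sorting or
    conjugating.  Let B(a, b) be the generating function of the cylindric pairs
    whose partitions have at most a and at most b parts.  The lengths of a
    cylindric pair differ by at most 1 ([cyl_length_gap]).  When |a - b| <= 1,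
    adding 1 to the first a entries of l and to the first b entries of m,
    missing parts being read as 0, is a bijection onto the pairs with exactly
    a and b parts ([add_cols_bij]), so these have generating function
    q^(a+b) B(a, b).  Splitting according to the lengths gives
      B(n+1, n) = q^(2n+1) B(n+1, n) + B(n, n), likewise for B(n, n+1), and
      B(n+1, n+1) = q^(2n+2) B(n+1, n+1)
                    + q^(2n+1) (B(n+1, n) + B(n, n+1)) + B(n, n),
    hence
      (1 - q^(2n+1)) (1 - q^(2n+2)) B(n+1, n+1) = (1 + q^(2n+1)) B(n, n)
    ([gf_box_rec]).  So B(n, n) is a quotient of two finite products, and the
    coefficients of q^i in B(n, n) and in both products are already those of
    the limits once i <= n. *)

Import GRing.Theory.

(** * Partitions and columns *)

Lemma is_part_cons x l :
  is_part (x :: l) = [&& (0 < x)%N, all (geq x) l & is_part l].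
Proof.
have geq_trans : transitive geq by move=> y x' z yx /leq_trans; apply.
rewrite /is_part /= (path_sortedE geq_trans) inE negb_or eq_sym -lt0n.
by case: (0 < x)%N; rewrite /= ?andbF // andbA.
Qed.

Lemma part_nth_gt0 l j : is_part l -> (0 < nth 0 l j)%N = (j < size l)%N.
Proof.
case/andP=> _ l0; case: (ltnP j) => jl; last by rewrite nth_default.
by rewrite lt0n; apply: contraNneq l0 => <-; rewrite mem_nth.
Qed.

(** When l has at most k parts, its Ferrers diagram gains a column of height k:
    the missing parts, read as 0, become the trailing ones. *)
Definition add_col k l := map succn l ++ nseq (k - size l) 1%N.

Lemma size_add_col k l : (size l <= k)%N -> size (add_col k l) = k.
Proof. by move=> lk; rewrite size_cat size_map size_nseq subnKC. Qed.

Lemma sumn_add_col k l : (size l <= k)%N -> sumn (add_col k l) = (k + sumn l)%N.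
Proof.
move=> lk; rewrite sumn_cat sumn_nseq mul1n.
have -> : sumn (map succn l) = (size l + sumn l)%N.
  by elim: l {lk} => //= x l ->; lia.
lia.
Qed.

Lemma nth_add_col k l j : (size l <= k)%N ->
  nth 0 (add_col k l) j = if (j < k)%N then (nth 0 l j).+1 else 0%N.
Proof.
move=> lk; rewrite nth_cat size_map nth_nseq; case: ltnP => jl.
  by rewrite (nth_map 0) // (leq_trans jl lk).
by rewrite [nth 0 l j]nth_default //; congr (if _ then _ else _); lia.
Qed.

Lemma add_col_part k l : is_part l -> is_part (add_col k l).
Proof.
rewrite /add_col; move: (k - size l)%N => n.
elim: l => [_|x l IHl].
  by elim: n => //= n IHn; rewrite is_part_cons IHn /= all_nseq orbT.
rewrite /= !is_part_cons all_cat all_map all_nseq /= => /and3P[_ xl /IHl ->].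
by rewrite orbT !andbT.
Qed.

Lemma add_col_inj k l m : is_part l -> is_part m ->
  (size l <= k)%N -> (size m <= k)%N -> add_col k l = add_col k m -> l = m.
Proof.
move=> pl pm lk mk e.
have nthE j : nth 0 l j = nth 0 m j.
  have := congr1 (nth 0 ^~ j) e; rewrite !nth_add_col //.
  by case: ltnP => [_ []|kj _] //; rewrite !nth_default //; lia.
apply: (@eq_from_nth _ 0%N) => [|j _ //].
have sizeE j : (j < size l)%N = (j < size m)%N by rewrite -!part_nth_gt0 ?nthE.
have := sizeE (size l); have := sizeE (size m); lia.
Qed.

(** The preimage is obtained by lowering every part of m by 1; the parts equal to
    1, which vanish, form the tail of m. *)
Lemma add_col_surj m : is_part m ->
  exists l, [/\ is_part l, (size l <= size m)%N & add_col (size m) l = m].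
Proof.
elim: m => [_|x m IHm]; first by exists [::].
rewrite is_part_cons => /and3P[x0 xm /IHm [l [pl lm mE]]].
have [x1|x1] := leqP x 1.
  exists [::]; split => //; rewrite /add_col /=; congr (_ :: _); first lia.
  (* All parts are bounded by the first one, so they are all equal to 1. *)
  apply/esym/all_pred1P; have: all (fun y => 0 < y)%N m.
    by apply/allP => y ym; rewrite lt0n; apply: contraTneq ym => ->;
       rewrite -mE; have /andP[] := add_col_part (size m) _ pl.
  by move=> m0; apply/allP => y ym; have := allP xm y ym; have := allP m0 y ym;
     move=> /= ? ?; apply/eqP; lia.
exists (x.-1 :: l); split=> //.
- rewrite is_part_cons pl andbT; apply/andP; split; first lia.
  move: xm; rewrite -mE all_cat all_map => /andP[xl _].
  by apply: sub_all xl => y /=; lia.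
- by rewrite /add_col /= subSS -[in RHS]mE /add_col; congr (_ :: _); lia.
Qed.

(** * Cylindric partitions of bounded length *)

Notation cyl := (cylindric (1, 1)%N).

Definition box a b : set (seq nat * seq nat) :=
  [set L | [/\ cyl L, (size L.1 <= a)%N & (size L.2 <= b)%N]]%classic.

Definition exact_box a b : set (seq nat * seq nat) :=
  [set L | [/\ cyl L, size L.1 = a & size L.2 = b]]%classic.

(** Past the end of one partition the interlacing conditions compare the other
    one, shifted by one place, with 0. *)
Lemma cyl_length_gap L : cyl L ->
  (size L.1 <= (size L.2).+1)%N /\ (size L.2 <= (size L.1).+1)%N.
Proof.
case=> pl pm /= c1 c2; split.
- have := c2 (size L.2); rewrite [leqRHS]nth_default // leqn0 addn1 => /eqP e.
  by rewrite leqNgt -part_nth_gt0 // e.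
- have := c1 (size L.1); rewrite [leqRHS]nth_default // leqn0 addn1 => /eqP e.
  by rewrite leqNgt -part_nth_gt0 // e.
Qed.

(** The condition [b <= a.+1] says that whenever the entry j+1 of m is raised,
    so is the entry j of l. *)
Lemma add_col_interlace a b l m :
  (b <= a.+1)%N -> (size l <= a)%N -> (size m <= b)%N ->
  (forall j, nth 0 (add_col b m) (j + 1) <= nth 0 (add_col a l) j)%N <->
  (forall j, nth 0 m (j + 1) <= nth 0 l j)%N.
Proof.
move=> ba la mb; split=> h j; have := h j; rewrite !nth_add_col //.
  case: (ltnP (j + 1) b) => jb; last by rewrite [nth 0 m _]nth_default //; lia.
  by rewrite ifT //; lia.
by case: (ltnP (j + 1) b) => jb //; rewrite ifT //; lia.
Qed.

Definition add_cols a b (L : seq nat * seq nat) :=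
  (add_col a L.1, add_col b L.2).

Lemma add_cols_bij a b : (a <= b.+1)%N -> (b <= a.+1)%N ->
  set_bij (box a b) (exact_box a b) (add_cols a b).
Proof.
move=> ab ba; split.
- move=> [l m] [[/= pl pm c1 c2] la mb]; split; rewrite /= ?size_add_col //.
  split=> /=; [exact: add_col_part|exact: add_col_part| |].
    exact/add_col_interlace.
  exact/add_col_interlace.
- move=> [l m] [l' m'] /set_mem[[/= pl pm _ _] la mb].
  move=> /set_mem[[/= pl' pm' _ _] la' mb'] [].
  by move=> /add_col_inj -> // /add_col_inj ->.
- move=> [l m] [[/= pl pm c1 c2] la mb]; subst a b.
  have [l' [pl' ll' lE]] := add_col_surj l pl.
  have [m' [pm' mm' mE]] := add_col_surj m pm.
  exists (l', m'); last by rewrite /add_cols /= lE mE.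
  split=> //; split=> //=.
    by rewrite -(add_col_interlace _ _ _ _ ba) // lE mE.
  by rewrite -(add_col_interlace _ _ _ _ ab) // lE mE.
Qed.

(** * Generating functions *)

Local Open Scope ring_scope.

Definition gf (A : set (seq nat * seq nat)) : fps int :=
  fps_fsum A (fun L => 'q ^+ cyl_size L).

Definition level n : set (seq nat * seq nat) :=
  [set L | cyl_size L = n]%classic.

(** Restricting the sum to one level makes its range finite when A consists of
    cylindric pairs, which additivity of sums over sets requires. *)
Lemma coef_gf A n : [gf A]_n = \sum_(L \in (A `&` level n)%classic) (1 : int).
Proof.
rewrite coef_Fps.
rewrite -(@fsbig_widen _ _ 0 +%R (A `&` level n)%classic A); first last.
- move=> L /= [AL nL]; rewrite coef_fpsXn; case: eqP => // e.
  by exfalso; apply: nL; split.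
- by move=> L [].
by apply: eq_fsbigr => L /set_mem[_ <-]; rewrite coef_fpsXn eqxx.
Qed.

Lemma gf_disjointU A B : (A `<=` cyl -> B `<=` cyl -> A `&` B `<=` set0 ->
  gf (A `|` B) = gf A + gf B)%classic.
Proof.
move=> Ac Bc AB0; apply/fpsP => n; rewrite coef_fpsD !coef_gf setIUl.
have fin C : (C `<=` cyl -> finite_set (C `&` level n))%classic.
  move=> Cc; apply: sub_finite_set (finite_cylindric (1, 1)%N n).
  by move=> L [CL Ln]; split=> //; exact: Cc.
by apply: fsbigU0; [exact: fin|exact: fin|move=> L [[AL _] [BL _]]; apply: AB0].
Qed.

Lemma coef_fpsXnM (R : comNzRingType) k (p : fps R) n :
  ['q ^+ k * p]_n = if (k <= n)%N then [p]_(n - k) else 0.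
Proof.
elim: k n => [|k IHk] n; first by rewrite mul1r subn0.
by rewrite exprS -mulrA coef_fpsMX; case: n => // n; rewrite IHk.
Qed.

Lemma gf_shift A B f k : set_bij A B f ->
  (forall L, A L -> cyl_size (f L) = k + cyl_size L)%N ->
  gf B = 'q ^+ k * gf A.
Proof.
move=> bf fk; apply/fpsP => n; rewrite coef_Fps (reindex_fsbig f A) //.
rewrite coef_fpsXnM; case: leqP => kn.
  rewrite coef_Fps; apply: eq_fsbigr => L /set_mem AL.
  by rewrite !coef_fpsXn fk //; congr (_%:R); lia.
apply: fsbig1 => L AL; rewrite coef_fpsXn fk //.
by case: eqP => // e; exfalso; lia.
Qed.

Lemma gf_exact_box a b : (a <= b.+1)%N -> (b <= a.+1)%N ->
  gf (exact_box a b) = 'q ^+ (a + b) * gf (box a b).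
Proof.
move=> ab ba; apply: (gf_shift _ _ (add_cols a b)); first exact: add_cols_bij.
move=> [l m] [_ la mb]; rewrite /cyl_size /= !sumn_add_col //.
by rewrite addnACA.
Qed.

(** A pair with n+1 parts on the left has at least n on the right, so it either
    has lengths exactly (n+1, n) or lies in the smaller box. *)
Lemma gf_box_succl n :
  gf (box n.+1 n) = gf (exact_box n.+1 n) + gf (box n n).
Proof.
rewrite -gf_disjointU; [|by move=> L []|by move=> L []|]; last first.
  by move=> L [[_ e _] [_ + _]]; rewrite e ltnn.
congr gf; apply/seteqP; split=> L.
  case=> cL ? ?; have := cyl_length_gap L cL.
  by have [?|?] := eqVneq (size L.1) n.+1; [left|right]; split=> //; lia.
by case=> -[cL ? ?]; split=> //; lia.
Qed.

Lemma gf_box_succr n :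
  gf (box n n.+1) = gf (exact_box n n.+1) + gf (box n n).
Proof.
rewrite -gf_disjointU; [|by move=> L []|by move=> L []|]; last first.
  by move=> L [[_ _ e] [_ _ +]]; rewrite e ltnn.
congr gf; apply/seteqP; split=> L.
  case=> cL ? ?; have := cyl_length_gap L cL.
  by have [?|?] := eqVneq (size L.2) n.+1; [left|right]; split=> //; lia.
by case=> -[cL ? ?]; split=> //; lia.
Qed.

Lemma gf_box_succ n :
  gf (box n.+1 n.+1) = gf (exact_box n.+1 n.+1) +
    (gf (exact_box n.+1 n) + (gf (exact_box n n.+1) + gf (box n n))).
Proof.
rewrite -(gf_disjointU (exact_box n n.+1));
  [|by move=> L []|by move=> L []|]; last first.
  by move=> L [[_ _ e] [_ _ +]]; rewrite e ltnn.
rewrite -(gf_disjointU (exact_box n.+1 n));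
  [|by move=> L []|by move=> L [] []|]; last first.
  by move=> L [[_ e f] [] [_ ? ?]]; lia.
rewrite -gf_disjointU; [|by move=> L []|by move=> L [|[]] []|]; last first.
  by move=> L [[_ e f] [|[]] [_ ? ?]]; lia.
congr gf; apply/seteqP; split=> L; last first.
  by case=> [|[|[]]] [cL ? ?]; split=> //; lia.
case=> cL ? ?; have := cyl_length_gap L cL => -[? ?].
have [?|?] := eqVneq (size L.1) n.+1; have [?|?] := eqVneq (size L.2) n.+1.
- by left.
- by right; left; split=> //; lia.
- by right; right; left; split=> //; lia.
- by right; right; right; split=> //; lia.
Qed.

(** Each box is a shifted copy of itself together with shifts of smaller boxes,
    so its generating function satisfies a linear equation.  The factor
    1 + q^(2n+1) arises as (1 - q^(2n+1)) + 2 q^(2n+1), where 2 counts the two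
    sides that can carry the extra part. *)
Lemma gf_box_rec n :
  (1 - 'q ^+ n.*2.+1) * (1 - 'q ^+ n.*2.+2) * gf (box n.+1 n.+1) =
  (1 + 'q ^+ n.*2.+1) * gf (box n n).
Proof.
have := gf_box_succ n; have := gf_box_succr n; have := gf_box_succl n.
rewrite !gf_exact_box ?(leqnn, leqW) //.
have -> : (n.+1 + n.+1 = n.*2.+2)%N by lia.
have -> : (n.+1 + n = n.*2.+1)%N by lia.
have -> : (n + n.+1 = n.*2.+1)%N by lia.
move: ('q ^+ n.*2.+1) ('q ^+ n.*2.+2) => a b.
move: (gf (box n n)) (gf (box n.+1 n)) (gf (box n n.+1)) (gf (box n.+1 n.+1)).
move=> p0 pl pr p1 el er e1.
have {}el : (1 - a) * pl = p0 by rewrite mulrBl mul1r {1}el; ring.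
have {}er : (1 - a) * pr = p0 by rewrite mulrBl mul1r {1}er; ring.
have {}e1 : (1 - b) * p1 = a * pl + a * pr + p0.
  by rewrite mulrBl mul1r {1}e1; ring.
rewrite -mulrA e1.
have -> : (1 - a) * (a * pl + a * pr + p0) =
  a * ((1 - a) * pl) + a * ((1 - a) * pr) + (1 - a) * p0 by ring.
by rewrite el er; ring.
Qed.

Lemma gf_box0 : gf (box 0 0) = 1.
Proof.
have -> : box 0 0 = [set ([::], [::])]%classic.
  apply/seteqP; split=> [[l m] [_ /=]|L -> //=].
    by rewrite !leqn0 !size_eq0 => /eqP-> /eqP->.
  by split=> //; split=> // j; rewrite !nth_nil.
by apply/fpsP => n; rewrite coef_Fps fsbig_set1.
Qed.

Lemma gf_box_prod n :
  \prod_(i < n.*2) (1 - 'q * 'q ^+ i) * gf (box n n) =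
  \prod_(i < n) (1 - - 'q * ('q ^+ 2) ^+ i).
Proof.
elim: n => [|n IHn]; first by rewrite !big_ord0 gf_box0 mulr1.
rewrite doubleS !big_ord_recr /= -IHn -!exprS -exprM mulNr opprK -exprS.
rewrite -mul2n -!mulrA [X in _ * X]mulrA mul2n gf_box_rec; ring.
Qed.

(** A partition has at most as many parts as its size, so the length bound m is
    no restriction on pairs of size n <= m. *)
Lemma coef_gf_box n m : (n <= m)%N ->
  [cyl_genfun (1%N, 1%N)]_n = [gf (box m m)]_n.
Proof.
move=> nm; rewrite -[cyl_genfun _]/(gf cyl) !coef_gf; apply: eq_fsbigl.
have size_le l : is_part l -> (size l <= sumn l)%N.
  by elim: l => //= x l IHl; rewrite is_part_cons => /and3P[x0 _ /IHl]; lia.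
apply/seteqP; split=> L [cL Ln]; last by case: cL.
split=> //; case: (cL) => /size_le pl /size_le pm _ _.
by move: Ln; rewrite /level /cyl_size /= => Ln; split=> //; lia.
Qed.

Theorem theorem3 :
  cyl_genfun (1%N, 1%N) = qpoch (- 'q) ('q ^+ 2) / qpoch 'q 'q.
Proof.
(* Clearing the denominator leaves an identity between convolutions, whose
   coefficients of degree n can be read off the box of side n+1. *)
apply: (mulIr (qpoch_unit _)); rewrite divrK ?qpoch_unit // mulrC.
have q20 : [('q : fps int) ^+ 2]_0 = 0 by rewrite coef_fpsXn.
apply/fpsP => n; rewrite coef_qpoch // -gf_box_prod !coef_fpsM.
apply: eq_bigr => i _; have := ltn_ord i => ni; congr (_ * _).
  by rewrite coef_qpoch //; apply/esym/qpoch_stable => //; lia.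
by apply: coef_gf_box; lia.
Qed.
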